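(* Let $n\ge 1$ and let $r_{\max}(n):=\left\lfloor (\sqrt{1+8n}-1)/2\right\rfloor$. Let $C_n$ be an extreme point of the elliptope $\mathcal{E}_n$ with $\mathrm{rank}(C_n)=r_{\max}(n)$. Then the $2n\times 2n$ matrix $$P_{C_n}:=\frac14\begin{pmatrix}J+C_n & J-C_n\\ J-C_n & J+C_n\end{pmatrix}$$ is a Gram-Lorentz matrix (in particular it is completely positive semidefinite), and $$\mathrm{cpsd}\text{-}\mathrm{rank}(P_{C_n})\ge \sqrt{2}^{\,\lfloor r_{\max}(n)/2\rfloor}.$$
   Context: $J$ denotes the $n\times n$ all-ones matrix. The elliptope is $\mathcal{E}_n:=\{X\in\mathcal{S}^n_+ : X_{ii}=1 \ \forall i\in[n]\}$, where $\mathcal{S}^n_+$ is the set of real symmetric positive semidefinite $n\times n$ matrices. The $m$-dimensional Lorentz cone is $\mathcal{L}_m:=\{(c,x)\in\mathbb{R}\times\mathbb{R}^{m-1}: c\ge\|x\|\}$. A real symmetric $N\times N$ matrix is Gram-Lorentz if it equals the Gram matrix $(\langle \ell_i,\ell_j\rangle)_{i,j}$ of some vectors $\ell_1,\dots,\ell_N\in\mathcal{L}_m$ for some $m\ge1$. A matrix $X$ of size $N$ is completely positive semidefinite (cpsd) if there exist $d\ge1$ and Hermitian positive semidefinite $d\times d$ matrices $P_1,\dots,P_N$ with $X_{ij}=\mathrm{Tr}(P_iP_j)$ for all $i,j$; the cpsd-rank of $X$ is the least such $d$. *)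

(* Defs.v *)
(* R : realType (MathComp-Analysis reals), complex numbers R[i]
   from mathcomp-real-closed. *)
From HB Require Import structures.
From mathcomp Require Import all_boot all_order all_algebra.
From mathcomp Require Import reals.
From mathcomp Require Import complex.
Set Implicit Arguments. Unset Strict Implicit. Unset Printing Implicit Defensive.
Import Order.TTheory GRing.Theory Num.Theory.
Local Open Scope ring_scope.

Section Defs.
Variable R : realType.

(* real symmetric positive semidefinite matrices *)
Definition psd_real (n : nat) (X : 'M[R]_n) : Prop :=
  X^T = X /\ forall v : 'cV[R]_n, 0 <= (v^T *m X *m v) 0 0.

(* the elliptope E_n *)
Definition elliptope (n : nat) (X : 'M[R]_n) : Prop :=
  psd_real X /\ forall i, X i i = 1.

(* extreme point of the elliptope (standard convex-analysis definition) *)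
Definition extreme_elliptope (n : nat) (X : 'M[R]_n) : Prop :=
  elliptope X /\
  forall (Y Z : 'M[R]_n) (t : R), elliptope Y -> elliptope Z ->
    0 < t -> t < 1 -> X = t *: Y + (1 - t) *: Z -> Y = X /\ Z = X.

(* r_max(n) = floor((sqrt(1+8n)-1)/2), as an integer *)
Definition rmax (n : nat) : int :=
  Num.floor ((Num.sqrt (1 + 8 * n%:R) - 1) / 2 : R).

(* the all-ones matrix J *)
Definition Jmx (n : nat) : 'M[R]_n := const_mx 1.

(* P_C = 1/4 [[J + C, J - C], [J - C, J + C]] *)
Definition PC (n : nat) (C : 'M[R]_n) : 'M[R]_(n + n) :=
  (1 / 4) *: block_mx (Jmx n + C) (Jmx n - C) (Jmx n - C) (Jmx n + C).

(* membership of (c, x) in R x R^k in the Lorentz cone L_(k+1) *)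
Definition lorentz (k : nat) (c : R) (x : 'rV[R]_k) : Prop :=
  Num.sqrt (\sum_(i < k) x 0 i ^+ 2) <= c.

(* Gram-Lorentz: X_ij = <l_i, l_j> with l_i = (c_i, x_i) in L_(k+1), m = k+1 >= 1 *)
Definition gram_lorentz (N : nat) (X : 'M[R]_N) : Prop :=
  exists (k : nat) (c : 'I_N -> R) (x : 'I_N -> 'rV[R]_k),
    (forall i, lorentz (c i) (x i)) /\
    forall i j, X i j = c i * c j + (x i *m (x j)^T) 0 0.

(* Hermitian positive semidefinite complex d x d matrices *)
Definition conjT (d : nat) (A : 'M[R[i]]_d) : 'M[R[i]]_d :=
  (map_mx (fun z : R[i] => z^*) A)^T.

Definition herm_psd (d : nat) (P : 'M[R[i]]_d) : Prop :=
  conjT P = P /\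
  forall v : 'cV[R[i]]_d, 0 <= ((map_mx (fun z : R[i] => z^*) v)^T *m P *m v) 0 0.

(* a cpsd factorization of X of size d: X_ij = Tr(P_i P_j), d >= 1 *)
Definition cpsd_factorization (N : nat) (X : 'M[R]_N) (d : nat)
    (P : 'I_N -> 'M[R[i]]_d) : Prop :=
  (0 < d)%N /\ (forall i, herm_psd (P i)) /\
  forall i j, ((X i j)%:C)%C = \tr (P i *m P j).

Definition cpsd (N : nat) (X : 'M[R]_N) : Prop :=
  exists (d : nat) (P : 'I_N -> 'M[R[i]]_d), @cpsd_factorization N X d P.

End Defs.
Arguments cpsd_factorization {R N} X d P.

(* Main.v *)
(* Write C = U U^T with the n x r matrix U of rank r = rank C.  The matrix P_C is
   the Gram matrix of the Lorentz vectors (1, +u_i)/2 and (1, -u_i)/2, where u_i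
   are the rows of U, and Clifford matrices g_k turn these vectors into the
   positive semidefinite matrices (1 +/- sum_k u_ik g_k) / (2 sqrt d).

   Conversely, in a factorization with matrices P_i^+, P_i^-, the traces force
   S = P_i^+ + P_i^- to be independent of i and P_i^+ P_i^- = 0, so that
   D_i = P_i^+ - P_i^- satisfies D_i^2 = S^2.  The D_i have Gram matrix C, whence
   D_i = sum_k u_ik G_k, and D_i^2 = S^2 says that the quadratic form
   u -> (sum_k u_k G_k)^2 - |u|^2 S^2 vanishes at every u_i.  Extremality of C
   means that no nonzero quadratic form does, so the G_k satisfy the Clifford
   relations on an eigenspace of S^2 with nonzero eigenvalue; halving that space
   repeatedly gives d >= 2^floor(r/2), which is stronger than required. *)
Require Import Defs.
From HB Require Import structures.
From mathcomp Require Import all_boot all_order all_algebra.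
From mathcomp Require Import boolp reals complex.
From mathcomp Require Import ring lra.
Import Order.TTheory GRing.Theory Num.Theory.
Local Open Scope ring_scope.
Set Implicit Arguments.
Unset Strict Implicit.
Unset Printing Implicit Defensive.

(** * Positive semidefinite Hermitian forms and their Gram factorizations *)

Section HermitianForms.
Variables (F : numFieldType) (s : {rmorphism F -> F}).
Hypothesis sK : involutive s.
Hypothesis s_ge0 : forall x, 0 <= s x * x.
Hypothesis s_id : forall x, 0 <= x -> s x = x.
Hypothesis s_sqrt : forall x, 0 <= x -> exists2 y, s y = y & y * y = x.

(** The adjoint for an abstract involution [s], so that one development serves the reals (identity)
    and the complex numbers (conjugation). *)
Definition ctmx m n (A : 'M[F]_(m, n)) : 'M[F]_(n, m) := (map_mx s A)^T.

Lemma ctmxK m n (A : 'M[F]_(m, n)) : ctmx (ctmx A) = A.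
Proof. by apply/matrixP=> i j; rewrite !mxE sK. Qed.

Lemma ctmxM m n p (A : 'M[F]_(m, n)) (B : 'M[F]_(n, p)) :
  ctmx (A *m B) = ctmx B *m ctmx A.
Proof. by rewrite /ctmx map_mxM trmx_mul. Qed.

Lemma ctmxD m n (A B : 'M[F]_(m, n)) : ctmx (A + B) = ctmx A + ctmx B.
Proof. by rewrite /ctmx map_mxD linearD. Qed.

Lemma ctmxB m n (A B : 'M[F]_(m, n)) : ctmx (A - B) = ctmx A - ctmx B.
Proof. by rewrite /ctmx map_mxB linearB. Qed.

Lemma ctmxZ m n a (A : 'M[F]_(m, n)) : ctmx (a *: A) = s a *: ctmx A.
Proof. by rewrite /ctmx map_mxZ linearZ. Qed.

Lemma ctmx1 n : ctmx (1%:M : 'M[F]_n) = 1%:M.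
Proof. by rewrite /ctmx map_mx1 trmx1. Qed.

Lemma mul_row_ctmx m n1 n2 (A : 'M[F]_(m, n1)) (B : 'M[F]_(m, n2)) :
  row_mx A B *m ctmx (row_mx A B) = A *m ctmx A + B *m ctmx B.
Proof. by rewrite /ctmx map_row_mx tr_row_mx mul_row_col. Qed.

Definition hpsd n (M : 'M[F]_n) : Prop :=
  ctmx M = M /\ forall v : 'cV[F]_n, 0 <= (ctmx v *m M *m v) 0 0.

Lemma mul_ctmxE m n (A : 'M[F]_(m, n)) j :
  (ctmx A *m A) j j = \sum_i s (A i j) * A i j.
Proof. by rewrite mxE; apply: eq_bigr => i _; rewrite !mxE. Qed.

Lemma mul_ctmx_ge0 m n (A : 'M[F]_(m, n)) j : 0 <= (ctmx A *m A) j j.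
Proof. by rewrite mul_ctmxE sumr_ge0. Qed.

Lemma mul_ctmx_diag_eq0 m n (A : 'M[F]_(m, n)) :
  (forall j, (ctmx A *m A) j j = 0) -> A = 0.
Proof.
move=> A0; apply/matrixP=> i j; rewrite mxE.
have /eqP := A0 j; rewrite mul_ctmxE psumr_eq0 // => /allP /(_ i).
by rewrite mem_index_enum mulf_eq0 fmorph_eq0 orbb => /(_ isT) /eqP.
Qed.

Lemma tr_mul_ctmx_eq0 m n (A : 'M[F]_(m, n)) : \tr (ctmx A *m A) = 0 -> A = 0.
Proof.
move=> /eqP; rewrite psumr_eq0 => [/allP A0|j _]; last exact: mul_ctmx_ge0.
by apply: mul_ctmx_diag_eq0 => j; apply/eqP/A0; rewrite mem_index_enum.
Qed.

Lemma hpsd_congr m n (M : 'M[F]_m) (B : 'M[F]_(m, n)) :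
  hpsd M -> hpsd (ctmx B *m M *m B).
Proof.
move=> [hM M0]; split=> [|v]; first by rewrite !ctmxM ctmxK hM mulmxA.
by have := M0 (B *m v); rewrite ctmxM !mulmxA.
Qed.

Lemma hpsd_ctmx_mul m n (B : 'M[F]_(m, n)) : hpsd (ctmx B *m B).
Proof.
rewrite -[ctmx B]mulmx1; apply: hpsd_congr; split=> [|v]; first exact: ctmx1.
by rewrite mulmx1 mul_ctmx_ge0.
Qed.

Lemma hpsdZ n a (M : 'M[F]_n) : 0 <= a -> hpsd M -> hpsd (a *: M).
Proof.
move=> a0 [hM M0]; split=> [|v]; first by rewrite ctmxZ s_id // hM.
by rewrite -scalemxAr -scalemxAl mxE mulr_ge0.
Qed.

(** Moving from v to v - t M v changes the form by t (t q - 2 p), which is negative for small t > 0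
    unless p = |M v|^2 is zero. *)
Lemma hpsd_ker n (M : 'M[F]_n) (v : 'cV[F]_n) :
  hpsd M -> (ctmx v *m M *m v) 0 0 = 0 -> M *m v = 0.
Proof.
move=> [hM M0] v0; set w := M *m v.
have wE : ctmx w = ctmx v *m M by rewrite ctmxM hM.
set p := (ctmx w *m w) 0 0; set q := (ctmx w *m M *m w) 0 0.
have p_ge0 : 0 <= p := mul_ctmx_ge0 w 0.
have q_ge0 : 0 <= q := M0 w.
apply: mul_ctmx_diag_eq0 => j; rewrite ord1 -/p.
apply/eqP; apply: contraT => p_neq0.
have p_gt0 : 0 < p by rewrite lt_def p_neq0.
have q1_gt0 : 0 < 1 + q by rewrite ltr_pwDl.
(* The summand 1 keeps the denominator positive when [q] is 0, and t q < p still holds. *)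
set t := p / (1 + q).
have t_gt0 : 0 < t by rewrite divr_gt0.
have := M0 (v - t *: w).
have -> : (ctmx (v - t *: w) *m M *m (v - t *: w)) 0 0 = t * (t * q - p *+ 2).
  rewrite ctmxB ctmxZ (s_id (ltW t_gt0)) !mulmxBl !mulmxBr -!scalemxAl -!scalemxAr.
  rewrite -wE -(mulmxA (ctmx w) M v) -/w; rewrite -wE in v0.
  rewrite /p /q; move: v0.
  move: (ctmx w *m v) (ctmx w *m w) (ctmx w *m M *m w) => X Y Z X0.
  rewrite !mxE X0; ring.
rewrite pmulr_rge0 // subr_ge0 => le_p2.
suff /lt_geF : t * q < p *+ 2 by rewrite le_p2.
rewrite mulr2n ltr_wpDl // mulrAC ltr_pdivrMr // ltr_pM2l //.
by rewrite ltrDr.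
Qed.

(* Subtracting (M v)(M v)^* / (v^* M v) keeps M positive semidefinite and lowers
   its rank by one. *)
Lemma hpsd_factor n r (M : 'M[F]_n) :
  hpsd M -> (\rank M <= r)%N -> exists U : 'M[F]_(n, r), M = U *m ctmx U.
Proof.
elim: r M => [|r IHr] M pM; first rewrite leqn0 mxrank_eq0 => /eqP ->.
  by exists 0; rewrite mul0mx.
move=> rkM; have [hM M0] := pM.
case: (pselect (exists v : 'cV_n, (ctmx v *m M *m v) 0 0 != 0)); last first.
  move=> nM; exists 0; rewrite mul0mx; apply/matrixP=> i j; rewrite mxE.
  have -> : M i j = (M *m delta_mx j 0 : 'cV_n) i 0 by rewrite -colE mxE.
  rewrite hpsd_ker //; first by rewrite mxE.
  by apply/eqP; apply: contraT => nv; case: nM; exists (delta_mx j 0).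
case=> v v_neq0; set a := (ctmx v *m M *m v) 0 0 in v_neq0.
have a_ge0 : 0 <= a := M0 v.
have aE : ctmx v *m M *m v = a%:M by rewrite [LHS]mx11_scalar.
have a'_ge0 : 0 <= a^-1 by rewrite invr_ge0.
have [y sy yy] := s_sqrt a'_ge0.
(* The projection along [v] that is orthogonal for the form [M]; congruence by it performs the
   subtraction, so positivity is inherited. *)
pose B : 'M_n := 1%:M - a^-1 *: (v *m ctmx v *m M).
have sa : s a^-1 = a^-1 := s_id a'_ge0.
have BE : ctmx B *m M *m B = M - a^-1 *: (M *m v *m (ctmx v *m M)).
  rewrite ctmxB ctmx1 ctmxZ sa !ctmxM hM ctmxK !mulmxBl !mulmxBr !mul1mx !mulmx1.
  rewrite -!scalemxAl -!scalemxAr !mulmxA.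
  rewrite -(mulmxA (M *m v) (ctmx v)) -(mulmxA (M *m v) (ctmx v *m M)) aE.
  rewrite mul_mx_scalar -!scalemxAl scalerA mulVf // scale1r.
  by rewrite !mulmxA subrr subr0.
have MbE : ctmx B *m M *m B = (1%:M - a^-1 *: (M *m v *m ctmx v)) *m M.
  by rewrite BE mulmxBl mul1mx -scalemxAl !mulmxA.
have [|U UE] := IHr _ (hpsd_congr B pM).
  have sub : (ctmx B *m M *m B <= M)%MS by rewrite MbE submxMl.
  rewrite -ltnS; apply: leq_trans rkM; rewrite ltn_neqAle mxrankS // andbT.
  apply/negP => /eqP rkE.
  (* Equal ranks would give equal row spaces, but the new form kills [v] while [M *m v] is
     nonzero. *)
  have : (M <= ctmx B *m M *m B)%MS by rewrite -(mxrank_leqif_sup sub) rkE.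
  case/submxP=> D DE.
  have Mv0 : M *m v = 0.
    rewrite DE -(mulmxA D) BE mulmxBl -scalemxAl -(mulmxA (M *m v)) aE mul_mx_scalar.
    by rewrite scalerA mulVf // scale1r subrr mulmx0.
  by move: v_neq0; rewrite /a -mulmxA Mv0 mulmx0 mxE eqxx.
have := mul_row_ctmx (y *: (M *m v)) U.
rewrite -UE BE ctmxZ ctmxM hM sy -scalemxAl -scalemxAr scalerA yy addrC subrK.
by exists (row_mx (y *: (M *m v)) U).
Qed.

(** Writing A = V V^* and B = U U^* turns the trace into the squared Frobenius norm of V^* U. *)
Lemma hpsd_mul_eq0 n (A B : 'M[F]_n) :
  hpsd A -> hpsd B -> \tr (A *m B) = 0 -> A *m B = 0.
Proof.
move=> pA pB; have [U ->] := hpsd_factor pB (leqnn _).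
have [V VE] := hpsd_factor pA (leqnn _).
rewrite mulmxA mxtrace_mulC VE !mulmxA -mulmxA => tr0.
suff -> : V *m ctmx V *m U = 0 by rewrite mul0mx.
rewrite -mulmxA (@tr_mul_ctmx_eq0 _ _ (ctmx V *m U)) ?mulmx0 //.
by rewrite ctmxM ctmxK -tr0.
Qed.

End HermitianForms.

(** * Nonzero eigenvalues, and the dimension forced by Clifford relations *)

Lemma exists_eigenvalue_neq0 (F : closedFieldType) d (T : 'M[F]_d) :
  \tr T != 0 -> exists2 l, l != 0 & eigenvalue T l.
Proof.
case: d T => [|d] T trT; first by rewrite /mxtrace big_ord0 eqxx in trT.
have [rs rsE] := closed_field_poly_normal (char_poly T).
move: rsE; rewrite (monicP (char_poly_monic T)) scale1r => rsE.
have [/hasP[l lrs l0]|/hasPn rs0] := boolP (has (fun l => l != 0) rs).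
  exists l => //; rewrite eigenvalue_root_char rsE.
  by rewrite root_prod_XsubC.
have szrs : size rs = d.+1.
  by apply/succn_inj; rewrite -(size_prod_XsubC rs id) -rsE size_char_poly.
(* The trace and the sum of the roots are both minus the same coefficient, so the trace would vanish
   if all roots did. *)
have := char_poly_trace T (ltn0Sn d).
have := @coefPn_prod_XsubC _ rs; rewrite -rsE szrs => -> // /oppr_inj trE.
case/eqP: trT; rewrite -trE big_seq big1 // => l /rs0 /negPn /eqP //.
Qed.

(* A_1 exchanges the two eigenspaces of A_0 in W, and the A_1 A_(k+2) satisfy the
   same relations on one of them, with l replaced by - l^2. *)
Lemma clifford_rank_bound (F : closedFieldType) d m (l : F) (A : nat -> 'M[F]_d)
    (W : 'M[F]_d) :
  2%:R != 0 :> F -> l != 0 -> W != 0 ->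
  (forall k (w : 'rV_d), (k < m.*2)%N -> (w <= W)%MS -> (w *m A k <= W)%MS) ->
  (forall k (w : 'rV_d), (k < m.*2)%N -> (w <= W)%MS ->
     w *m A k *m A k = l *: w) ->
  (forall j k (w : 'rV_d), (j < m.*2)%N -> (k < m.*2)%N -> j != k ->
     (w <= W)%MS -> w *m A j *m A k = - (w *m A k *m A j)) ->
  (2 ^ m <= \rank W)%N.
Proof.
move=> two_neq0; elim: m l A W => [|m IHm] l A W l0 W0 stabA sqA acA.
  by rewrite expn0 lt0n mxrank_eq0.
have [mu muE] : exists mu : F, mu * mu = l.
  have := @solve_monicpoly F 2 (fun i => if i == 0%N then l else 0) isT.
  case=> mu; rewrite !big_ord_recl big_ord0 /= expr0 mulr1 expr1 mul0r !addr0.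
  by rewrite expr2; exists mu.
have mu0 : mu != 0 by apply: contraNneq l0 => mu0; rewrite -muE mu0 mul0r.
have lt0 : (0 < m.+1.*2)%N by [].
have lt1 : (1 < m.+1.*2)%N by [].
set V := (W :&: eigenspace (A 0%N) mu)%MS.
have VP (w : 'rV_d) :
    (w <= V)%MS = (w <= W)%MS && (w *m A 0%N == mu *: w).
  by rewrite sub_capmx; congr (_ && _); apply/eigenspaceP/eqP.
have V0 : V != 0.
  have [i wi0] : exists i, row i W != 0.
    apply/existsP; apply: contraT => /existsPn W_0; case/eqP: W0.
    by apply/row_matrixP=> i; rewrite row0; apply/eqP/negPn/W_0.
  set w := row i W in wi0; have wW : (w <= W)%MS := row_sub i W.
  (* w A_0 + mu w is an eigenvector for mu unless it is zero; in that case w belongs to -mu, and A_1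
     carries it to mu. *)
  have [w' w'0 w'V] : exists2 w' : 'rV_d, w' != 0 & (w' <= V)%MS.
    have [u0|u0] := eqVneq (w *m A 0%N + mu *: w) 0.
      exists (w *m A 1%N).
        apply: contraNneq wi0 => w1; have := sqA _ _ lt1 wW.
        by rewrite w1 mul0mx => /esym/eqP; rewrite scaler_eq0 (negPf l0).
      rewrite VP stabA // acA // (_ : w *m A 0%N = - (mu *: w)).
        by rewrite mulNmx opprK scalemxAl eqxx.
      by apply/eqP; rewrite -addr_eq0 u0.
    exists (w *m A 0%N + mu *: w) => //.
    rewrite VP addmx_sub ?scalemx_sub ?stabA //= mulmxDl sqA // -scalemxAl.
    by rewrite scalerDr scalerA muE addrC.
  by apply: contraNneq w'0 => V0; rewrite -submx0 -V0.
have VW (w : 'rV_d) : (w <= V)%MS -> (w <= W)%MS by rewrite VP => /andP[].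
(* Both factors anticommute with A_0 on [W], so their product commutes with it and preserves [V].
   Two matrices are used up, matching the drop of [m] by one. *)
pose A' k := A 1%N *m A k.+2.
have lt2 k : (k < m.*2)%N -> (k.+2 < m.+1.*2)%N by rewrite doubleS.
have le_m : (2 ^ m <= \rank V)%N.
  apply: (IHm (- (l * l)) A') => //; first by rewrite oppr_eq0 mulf_neq0.
  - move=> k w /lt2 lk; rewrite VP => /andP[wW /eqP wmu].
    rewrite VP /A' mulmxA !stabA //= acA ?stabA // [w *m _ *m _]acA //.
    by rewrite mulNmx opprK wmu -!scalemxAl.
  - move=> k w /lt2 lk /VW wW; rewrite /A' !mulmxA.
    rewrite (acA k.+2 1%N) ?stabA // mulNmx !sqA ?scalemx_sub ?stabA //.
    by rewrite scalerA scaleNr.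
  - move=> j k w /lt2 lj /lt2 lk; rewrite -2!eqSS => jk /VW wW; rewrite /A' !mulmxA.
    rewrite (acA j.+2 1%N) ?stabA // (acA k.+2 1%N) ?stabA // !mulNmx opprK.
    by rewrite !sqA // -!scalemxAl acA // scalerN opprK.
have V1W : (V *m A 1%N <= W)%MS.
  by apply/row_subP=> i; rewrite row_mul stabA // VW // row_sub.
have rkV1 : (\rank V <= \rank (V *m A 1%N))%N.
  have VE : V *m A 1%N *m A 1%N = l *: V.
    by apply/row_matrixP=> i; rewrite !row_mul sqA ?VW ?row_sub // linearZ.
  by rewrite -(eqmx_scale V l0) -VE mxrankM_maxl.
(* A_1 sends [V] into the eigenspace for -mu, which meets [V] trivially because 2 mu is nonzero; [W]
   thus contains two independent copies of [V]. *)
have capV : (V :&: (V *m A 1%N))%MS = 0.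
  apply/eqP; rewrite -submx0; apply/rV_subP=> w; rewrite sub_capmx => /andP[].
  rewrite VP => /andP[_ /eqP wmu] /submxP[D wE].
  have DV : (D *m V <= V)%MS by rewrite submxMl.
  move: (DV); rewrite VP => /andP[DW /eqP Dmu].
  have w2 : w *m A 0%N = - (mu *: w).
    by rewrite wE mulmxA acA // Dmu -!scalemxAl.
  rewrite submx0; move: w2; rewrite wmu => /eqP; rewrite -addr_eq0 -mulr2n.
  by rewrite -scaler_nat scalerA scaler_eq0 mulf_eq0 (negPf two_neq0) (negPf mu0).
have : (V + V *m A 1%N <= W)%MS by rewrite addsmx_sub capmxSl.
move/mxrankS; rewrite mxrank_disjoint_sum //; apply: leq_trans.
by rewrite expnS mul2n -addnn leq_add // (leq_trans le_m).
Qed.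

(** * Anticommutators and the existence of Clifford generators *)

Section Anticommutators.
Variables (F : comNzRingType) (d r : nat) (G : 'I_r -> 'M[F]_d).

Lemma anticomm_sum (a b : 'I_r -> F) :
  (\sum_k a k *: G k) *m (\sum_k b k *: G k) +
    (\sum_k b k *: G k) *m (\sum_k a k *: G k) =
  \sum_k \sum_l (a k * b l) *: (G k *m G l + G l *m G k).
Proof.
rewrite !mulmx_suml; under eq_bigr do rewrite mulmx_sumr.
under [in X in _ + X]eq_bigr do rewrite mulmx_sumr.
rewrite [X in _ + X]exchange_big /= -big_split; apply: eq_bigr => k _.
rewrite -big_split; apply: eq_bigr => l _ /=.
by rewrite -!scalemxAl -!scalemxAr !scalerA scalerDr [b l * _]mulrC.
Qed.

Lemma clifford_anticomm (T : 'M[F]_d) (a b : 'I_r -> F) :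
  (forall k l, G k *m G l + G l *m G k = ((k == l)%:R *+ 2) *: T) ->
  (\sum_k a k *: G k) *m (\sum_k b k *: G k) +
    (\sum_k b k *: G k) *m (\sum_k a k *: G k) = ((\sum_k a k * b k) *+ 2) *: T.
Proof.
move=> GT; rewrite anticomm_sum -sumrMnl scaler_suml; apply: eq_bigr => k _.
rewrite (bigD1 k) //= big1 ?addr0 => [|l /negPf lk]; last first.
  by rewrite GT eq_sym lk mul0rn scale0r scaler0.
by rewrite GT eqxx scalerA mulrnAr mulr1.
Qed.

End Anticommutators.

(** Each new generator doubles the dimension: the old ones become diag(G, -G) and the new one swaps
    the two blocks. The relations are demanded only below [r], so zero matrices of size 1 start the
    induction. *)
Lemma exists_clifford (F : numFieldType) (s : {rmorphism F -> F}) r :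
  exists d (G : nat -> 'M[F]_d), [/\ (0 < d)%N,
    forall k, ctmx s (G k) = G k,
    forall k, \tr (G k) = 0 &
    forall k l, (k < r)%N -> (l < r)%N ->
      G k *m G l + G l *m G k = ((k == l)%:R *+ 2) *: 1%:M].
Proof.
elim: r => [|r [d [G [d0 hG trG GG]]]].
  exists 1%N, (fun=> 0); split=> // k; last by rewrite linear0.
  by rewrite /ctmx map_mx0 trmx0.
pose H k := if k == r then block_mx 0 1%:M 1%:M 0
            else block_mx (G k) 0 0 (- G k).
exists (d + d)%N, H; split=> [|k|k|k l lk ll]; first by rewrite addn_gt0 d0.
- rewrite /H /ctmx; case: eqP => _; rewrite map_block_mx tr_block_mx !map_mx0 !trmx0.
    by rewrite map_mx1 trmx1.
  by rewrite map_mxN linearN /= -/(ctmx s (G k)) hG.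
- rewrite /H; case: eqP => _; rewrite mxtrace_block ?linear0 ?addr0 //.
  by rewrite linearN /= subrr.
have sc (a : F) : a *: (1%:M : 'M_(d + d)) = block_mx (a *: 1%:M) 0 0 (a *: 1%:M).
  by rewrite scalar_mx_block scale_block_mx !scaler0.
rewrite sc /H; have [kr|kr] := boolP (k == r); have [lr|lr] := boolP (l == r).
- rewrite (eqP kr) (eqP lr) eqxx !mulmx_block !(mulmx0, mul0mx, mulmx1, add0r, addr0).
  by rewrite add_block_mx !addr0 -mulr2n scaler_nat.
- rewrite (eqP kr) eq_sym (negPf lr) !mulmx_block.
  rewrite !(mulmx0, mul0mx, mulmx1, mul1mx, add0r, addr0) add_block_mx.
  by rewrite !(addr0, subrr, addNr) mul0rn scale0r.
- rewrite (eqP lr) (negPf kr) !mulmx_block.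
  rewrite !(mulmx0, mul0mx, mulmx1, mul1mx, add0r, addr0) add_block_mx.
  by rewrite !(addr0, subrr, addNr) mul0rn scale0r.
rewrite !mulmx_block !(mulmx0, mul0mx, add0r, addr0) add_block_mx !addr0.
rewrite !mulNmx !mulmxN !opprK GG //.
  by rewrite ltn_neqAle kr -ltnS.
by rewrite ltn_neqAle lr -ltnS.
Qed.

(** * Real Gram representations and extreme points of the elliptope *)

Section RealGram.
Variable R : realType.

Lemma psd_real_gram n (C : 'M[R]_n) :
  psd_real C -> exists U : 'M[R]_(n, \rank C), C = U *m U^T.
Proof.
have adjE m p (A : 'M[R]_(m, p)) : ctmx idfun A = A^T by rewrite /ctmx map_mx_id.
move=> [CT C0]; have [||||||U CE] := @hpsd_factor R idfun _ _ _ _ n (\rank C) C.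
- by [].
- by move=> x; rewrite -expr2 sqr_ge0.
- by [].
- by move=> x x0; exists (Num.sqrt x); rewrite // -expr2 sqr_sqrtr.
- by split=> [|v]; rewrite adjE.
- by [].
by exists U; rewrite {1}CE adjE.
Qed.

Lemma gram_left_inverse n r (C : 'M[R]_n) (U : 'M[R]_(n, r)) :
  C = U *m U^T -> \rank C = r -> exists L : 'M[R]_(r, n), L *m U = 1%:M.
Proof.
move=> CE rC; suff /row_fullP[L LU] : row_full U by exists L.
rewrite /row_full eqn_leq rank_leq_col -{1}rC CE; exact: mxrankM_maxl.
Qed.

(** Since |v_k v_l| <= |v|^2, the form of [M] is at most [m] |v|^2 in absolute value, with [m] the
    sum of the |M_kl|. The radius 1/(1+m) also covers M = 0. *)
Lemma psd_perturb r (M : 'M[R]_r) :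
  exists2 e : R, 0 < e & forall a, `|a| <= e ->
    forall v : 'cV_r, 0 <= (v^T *m (1%:M + a *: M) *m v) 0 0.
Proof.
pose m := \sum_k \sum_l `|M k l|.
have m0 : 0 <= m by do 2!apply: sumr_ge0 => ? _.
have m1 : 0 < 1 + m by rewrite ltr_pwDl.
exists (1 + m)^-1 => [|a ae v]; first by rewrite invr_gt0.
pose q := \sum_k v k 0 ^+ 2.
have q0 : 0 <= q by apply: sumr_ge0 => ? _; exact: sqr_ge0.
have le_q k : v k 0 ^+ 2 <= q.
  by rewrite /q (bigD1 k) //= lerDl sumr_ge0 // => ? _; exact: sqr_ge0.
pose x := \sum_k \sum_l M k l * (v k 0 * v l 0).
have vMv : (v^T *m (1%:M + a *: M) *m v) 0 0 = q + a * x.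
  rewrite mulmxDr mulmx1 mulmxDl -scalemxAr -scalemxAl !mxE; congr (_ + a * _).
    by apply: eq_bigr => k _; rewrite !mxE expr2.
  rewrite /x exchange_big; apply: eq_bigr => l _; rewrite mxE mulr_suml.
  by apply: eq_bigr => k _; rewrite !mxE; ring.
have xm : `|x| <= m * q.
  rewrite /m mulr_suml (le_trans (ler_norm_sum _ _ _)) // ler_sum // => k _.
  rewrite mulr_suml (le_trans (ler_norm_sum _ _ _)) // ler_sum // => l _.
  rewrite normrM ler_wpM2l // ler_norml; have := le_q k; have := le_q l.
  have := sqr_ge0 (v k 0 + v l 0); have := sqr_ge0 (v k 0 - v l 0).
  by rewrite sqrrB sqrrD => *; apply/andP; split; lra.
rewrite vMv -[a * x]opprK subr_ge0 -mulNr.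
apply: le_trans (ler_norm _) _; rewrite normrM normrN.
apply: le_trans (_ : (1 + m)^-1 * (m * q) <= _); first exact: ler_pM.
by rewrite ler_pdivrMl // mulrDl mul1r lerDr.
Qed.

(** C is the midpoint of the matrices U (1 + e M) U^T and U (1 - e M) U^T, which stay in the
    elliptope for small e. Extremality gives U M U^T = 0, and a left inverse of U recovers M. *)
Lemma extreme_gram_annihilator n r (C : 'M[R]_n) (U : 'M_(n, r)) (M : 'M_r) :
  extreme_elliptope C -> C = U *m U^T -> \rank C = r -> M^T = M ->
  (forall i, (U *m M *m U^T) i i = 0) -> M = 0.
Proof.
move=> [[_ C1] extC] CE rC MT MU; have [L LU] := gram_left_inverse CE rC.
have [e e0 eM] := psd_perturb M.
have ell a : `|a| <= e -> elliptope (C + a *: (U *m M *m U^T)).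
  move=> ae; split=> [|i]; last by rewrite 2!mxE MU mulr0 addr0.
  have -> : C + a *: (U *m M *m U^T) = U *m (1%:M + a *: M) *m U^T.
    by rewrite mulmxDr mulmxDl mulmx1 -CE -scalemxAr -scalemxAl.
  split=> [|v]; last by have := eM a ae (U^T *m v); rewrite trmx_mul trmxK !mulmxA.
  by rewrite !trmx_mul trmxK linearD linearZ /= MT trmx1 mulmxA.
have [|||||+ _] := extC (C + e *: (U *m M *m U^T)) (C + (- e) *: (U *m M *m U^T)) 2^-1.
- by apply: ell; rewrite gtr0_norm.
- by apply: ell; rewrite normrN gtr0_norm.
- by rewrite invr_gt0.
- by rewrite invf_lt1 // ltr1n.
- by apply/matrixP=> i j; rewrite !mxE; field.
move=> /eqP; rewrite -subr_eq0 addrAC subrr add0r scaler_eq0 gt_eqF //= => /eqP UMU.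
have : L *m (U *m M *m U^T) *m L^T = M.
  by rewrite !mulmxA LU mul1mx -mulmxA -trmx_mul LU trmx1 mulmx1.
by rewrite UMU mulmx0 mul0mx.
Qed.

End RealGram.

(** * Lorentz vectors and a positive semidefinite factorization for [PC C] *)

Section PCGram.
Variables (R : realType) (n r : nat) (C : 'M[R]_n) (U : 'M[R]_(n, r)).
Hypothesis CE : C = U *m U^T.
Hypothesis C1 : forall i, C i i = 1.

Lemma signed_gram :
  col_mx U (- U) *m (col_mx U (- U))^T = block_mx C (- C) (- C) C.
Proof.
have UN : (- U)^T = - U^T by rewrite linearN.
by rewrite tr_col_mx mul_col_row UN !mulNmx !mulmxN opprK -CE.
Qed.

Lemma PC_gram i j :
  PC C i j = (1 + (col_mx U (- U) *m (col_mx U (- U))^T) i j) / 4.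
Proof.
rewrite signed_gram.
rewrite /PC mxE mulrC div1r; congr (_ / 4).
by case: (split_ordP i) => i' ->; case: (split_ordP j) => j' ->;
  rewrite ?(block_mxEul, block_mxEur, block_mxEdl, block_mxEdr) !mxE.
Qed.

Lemma signed_gram_diag i : (col_mx U (- U) *m (col_mx U (- U))^T) i i = 1.
Proof.
rewrite signed_gram.
by case: (split_ordP i) => i' ->; rewrite ?(block_mxEul, block_mxEdr) C1.
Qed.

Lemma gram_lorentz_PC : gram_lorentz (PC C).
Proof.
pose V := col_mx U (- U).
(* The rows of [V] are unit vectors, so these points lie on the boundary of the cone. *)
exists r, (fun=> 2^-1), (fun i => 2^-1 *: row i V); split=> [i|i j].
  rewrite /lorentz (_ : \sum_k _ = 2^-1 ^+ 2) ?sqrtr_sqr ?ger0_norm ?invr_ge0 //.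
  rewrite -[RHS]mulr1 -(signed_gram_diag i) mxE mulr_sumr.
  by apply: eq_bigr => k _; rewrite !mxE exprMn -expr2.
have -> : (2^-1 *: row i V *m (2^-1 *: row j V)^T) 0 0 = 4^-1 * (V *m V^T) i j.
  rewrite !mxE mulr_sumr; apply: eq_bigr => k _; by rewrite !mxE; field.
by rewrite PC_gram; field.
Qed.

Lemma cpsd_PC : cpsd (PC C).
Proof.
pose V := col_mx U (- U).
have [d [G [d0 hG trG GG]]] := exists_clifford (@Num.conj R[i]) r.
pose B i := \sum_(k < r) (V i k)%:C%C *: G k.
have sumV i j : \sum_k (V i k)%:C%C * (V j k)%:C%C = ((V *m V^T) i j)%:C%C.
  rewrite mxE rmorph_sum; apply: eq_bigr => k _.
  by rewrite [V^T k j]mxE rmorphM.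
have BB i j : B i *m B j + B j *m B i = (((V *m V^T) i j)%:C%C *+ 2) *: 1%:M.
  by rewrite -sumV; apply: (clifford_anticomm (G := fun k => G k)) => k l; rewrite GG.
have two0 : (2 : R[i]) != 0 by rewrite pnatr_eq0.
have sqB i : B i *m B i = 1%:M.
  have := BB i i; rewrite signed_gram_diag -!mulr2n scaler_nat => /eqP.
  by rewrite -subr_eq0 -mulrnBl -scaler_nat scaler_eq0 (negPf two0) subr_eq0 => /eqP.
have trB i : \tr (B i) = 0.
  by rewrite linear_sum big1 // => k _; rewrite linearZ /= trG mulr0.
have trBB i j : \tr (B i *m B j) = ((V *m V^T) i j)%:C%C * d%:R.
  have /(congr1 (@mxtrace _ _)) := BB i j.
  rewrite linearD /= [X in _ + X]mxtrace_mulC linearZ /= mxtrace1 -mulr2n.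
  by rewrite mulrnAl => /(pmulrnI (isT : (0 < 2)%N)).
have hB i : ctmx Num.conj (B i) = B i.
  rewrite /ctmx /B map_mx_sum linear_sum; apply: eq_bigr => k _.
  rewrite map_mxZ linearZ /= -/(ctmx _ _) hG; congr (_ *: _).
  exact: conjc_real.
(* The trace of (1 + B_i)(1 + B_j) is d (1 + <v_i, v_j>), so the scale must satisfy c^2 d = 1/4. *)
pose c : R := (2 * Num.sqrt d%:R)^-1.
have sd0 : 0 < Num.sqrt (d%:R : R) by rewrite sqrtr_gt0 ltr0n.
have cc : c ^+ 2 * d%:R = 4^-1.
  rewrite -[d%:R]sqr_sqrtr ?ler0n // /c; field.
  by rewrite gt_eqF.
have c_ge0 : 0 <= (c / 2)%:C%C.
  by rewrite ler0c divr_ge0 // invr_ge0 mulr_ge0 // ltW.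
exists d, (fun i => c%:C%C *: (1%:M + B i)); split=> //; split=> [i|i j].
  (* As B_i^2 = 1, the square of 1 + B_i is twice itself, which exhibits positivity. *)
  have -> : c%:C%C *: (1%:M + B i) =
      (c / 2)%:C%C *: (ctmx Num.conj (1%:M + B i) *m (1%:M + B i)).
    rewrite ctmxD ctmx1 hB.
    rewrite mulmxDl !mulmxDr !mul1mx !mulmx1 sqB addrACA [B i + _]addrC.
    rewrite -mulr2n -scaler_nat scalerA; congr (_ *: _).
    by rewrite -(rmorph_nat (real_complex R) 2) -rmorphM divfK ?pnatr_eq0.
  apply: hpsdZ => //; first exact: geC0_conj.
  apply: hpsd_ctmx_mul; first exact: conjCK.
  by move=> x; rewrite mulrC mul_conjC_ge0.
rewrite -scalemxAr -scalemxAl scalerA linearZ /=.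
rewrite mulmxDl !mulmxDr !mul1mx !mulmx1 !linearD /= !trB trBB mxtrace1 PC_gram.
rewrite -cc -/V addr0 add0r -(rmorph_nat (real_complex R) d) -!rmorphM -rmorphD -rmorphM.
by congr (_%:C%C); ring.
Qed.

End PCGram.

(** * Clifford relations inside an arbitrary cpsd factorization *)

Section LowerBound.
Variables (R : realType).

Lemma herm_psd_mul_eq0 d (A B : 'M[R[i]]_d) :
  herm_psd A -> herm_psd B -> \tr (A *m B) = 0 -> A *m B = 0.
Proof.
apply: (@hpsd_mul_eq0 R[i] Num.conj).
- exact: conjCK.
- by move=> x; rewrite mulrC mul_conjC_ge0.
- exact: geC0_conj.
- move=> x x0; exists (sqrtC x); first by apply: geC0_conj; rewrite sqrtC_ge0.
  by rewrite -expr2 sqrtCK.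
Qed.

Lemma herm_sqr_eq0 d (H : 'M[R[i]]_d) :
  ctmx Num.conj H = H -> \tr (H *m H) = 0 -> H = 0.
Proof.
move=> hH trH; apply: (@tr_mul_ctmx_eq0 R[i] Num.conj); last by rewrite hH.
by move=> x; rewrite mulrC mul_conjC_ge0.
Qed.

(** The real statement is applied to the real and imaginary parts of [Q]; both are R-linear maps, so
    [ann] treats them together. *)
Lemma extreme_gram_annihilatorC n r (C : 'M[R]_n) (U : 'M_(n, r))
    (Q : 'I_r -> 'I_r -> R[i]) :
  extreme_elliptope C -> C = U *m U^T -> \rank C = r ->
  (forall k l, Q k l = Q l k) ->
  (forall i, \sum_k \sum_l (U i k * U i l)%:C%C * Q k l = 0) ->
  forall k l, Q k l = 0.
Proof.
move=> extC CE rC Qsym UQ.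
have ann (f : R[i] -> R) : f 0 = 0 -> {morph f : x y / x + y} ->
    (forall (a : R) z, f (a%:C%C * z) = a * f z) -> forall k l, f (Q k l) = 0.
  move=> f0 fD fZ k l; pose M := \matrix_(k, l) f (Q k l).
  suff /matrixP/(_ k l) : M = 0 by rewrite !mxE.
  apply: (extreme_gram_annihilator extC CE rC) => [|i].
    by apply/matrixP=> k' l'; rewrite !mxE Qsym.
  rewrite -[RHS]f0 -(UQ i) (big_morph f fD f0) mxE.
  rewrite (eq_bigr (fun l => \sum_k U i k * M k l * U i l)); last first.
    by move=> l' _; rewrite [U^T _ _]mxE [(U *m M) _ _]mxE mulr_suml.
  rewrite exchange_big; apply: eq_bigr => k' _.
  rewrite (big_morph f fD f0); apply: eq_bigr => l' _.
  by rewrite fZ mxE mulrAC.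
move=> k l; apply/eqP; rewrite eq_complex; apply/andP; split; apply/eqP.
  by apply: (ann (@complex.Re R)) => // [[? ?] [? ?]|a [x y]] //=; ring.
by apply: (ann (@complex.Im R)) => // [[? ?] [? ?]|a [x y]] //=; ring.
Qed.

Section Factorization.
Variables (n d r : nat) (C : 'M[R]_n) (U : 'M[R]_(n, r)).
Hypotheses (extC : extreme_elliptope C) (CE : C = U *m U^T) (rC : \rank C = r).
Variable (P : 'I_(n + n) -> 'M[R[i]]_d).
Hypothesis facP : cpsd_factorization (PC C) d P.

Local Notation p i := (P (lshift n i)).
Local Notation m i := (P (rshift n i)).

Let C1 i : C i i = 1. Proof. by case: extC => [[_ ->]]. Qed.
Let herm i : ctmx Num.conj (P i) = P i.
Proof. by case: facP => _ [/(_ i)[]]. Qed.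

Lemma cpsd_traces i j :
  [/\ \tr (p i *m p j) = ((1 + C i j) / 4)%:C%C,
      \tr (p i *m m j) = ((1 - C i j) / 4)%:C%C,
      \tr (m i *m p j) = ((1 - C i j) / 4)%:C%C &
      \tr (m i *m m j) = ((1 + C i j) / 4)%:C%C].
Proof.
case: facP => _ [_ trP]; rewrite -!trP.
by split; rewrite (PC_gram CE) (signed_gram CE)
  ?(block_mxEul, block_mxEur, block_mxEdl, block_mxEdr) // ?mxE.
Qed.

Let S i := p i + m i.
Let D i := p i - m i.

(** All traces of S_k S_l equal 1, so the Hermitian matrix S_i - S_j has Frobenius norm zero. *)
Lemma cpsd_sum_const i j : S i = S j.
Proof.
apply/eqP; rewrite -subr_eq0; apply/eqP/herm_sqr_eq0.
  by rewrite ctmxB !ctmxD !herm.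
have trS k l : \tr (S k *m S l) = 1.
  rewrite mulmxDl !mulmxDr !linearD /=; have [-> -> -> ->] := cpsd_traces k l.
  by rewrite -!rmorphD -(rmorph1 (real_complex R)); congr (_%:C%C); field.
by rewrite mulmxBl !mulmxBr !linearB /= !trS !subrr addr0.
Qed.

Lemma cpsd_diff_trace i j : \tr (D i *m D j) = (C i j)%:C%C.
Proof.
rewrite mulmxBl !mulmxBr !linearB /=; have [-> -> -> ->] := cpsd_traces i j.
rewrite -!(rmorphN, rmorphB, rmorphD).
by apply: (congr1 (real_complex R)); field.
Qed.

(** C_ii = 1 makes the trace of [p i *m m i] zero, so both cross products vanish, and they are all
    that separates D_i^2 from S_i^2. *)
Lemma cpsd_diff_sqr i j : D i *m D i = S j *m S j.
Proof.
rewrite (cpsd_sum_const j i) mulmxBl !mulmxBr mulmxDl !mulmxDr.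
have [_ trpm trmp _] := cpsd_traces i i.
have psdP k : herm_psd (P k) by case: facP => _ [].
rewrite (@herm_psd_mul_eq0 _ (p i) (m i)) //; last first.
  by rewrite trpm C1 subrr mul0r rmorph0.
rewrite (@herm_psd_mul_eq0 _ (m i) (p i)) //; last first.
  by rewrite trmp C1 subrr mul0r rmorph0.
by rewrite subr0 sub0r opprK addr0 add0r.
Qed.

(** The squared Frobenius norm of the combination is x C x^T. *)
Lemma cpsd_diff_linear (x : 'rV[R]_n) :
  x *m C = 0 -> \sum_i (x 0 i)%:C%C *: D i = 0.
Proof.
move=> xC; apply: herm_sqr_eq0.
  rewrite /ctmx map_mx_sum linear_sum; apply: eq_bigr => i _.
  rewrite map_mxZ linearZ /= -/(ctmx _ _) ctmxB !herm; congr (_ *: _).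
  exact: conjc_real.
rewrite mulmx_sumr linear_sum big1 // => j _; rewrite mulmx_suml linear_sum /=.
have /matrixP/(_ 0 j) := xC; rewrite !mxE => xCj.
transitivity ((x 0 j)%:C%C * (\sum_i x 0 i * C i j)%:C%C).
  rewrite rmorph_sum mulr_sumr; apply: eq_bigr => i _.
  rewrite -scalemxAl -scalemxAr !linearZ /= cpsd_diff_trace rmorphM /=.
  by rewrite mulrCA.
by rewrite xCj rmorph0 mulr0.
Qed.

Lemma cpsd_clifford : (0 < n)%N ->
  exists T (G : 'I_r -> 'M[R[i]]_d), \tr T = 1 /\
    forall k l, G k *m G l + G l *m G k = ((k == l)%:R *+ 2) *: T.
Proof.
move=> n0; pose i0 := Ordinal n0; pose T := S i0 *m S i0.
have [L LU] := gram_left_inverse CE rC.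
pose G k := \sum_i (L k i)%:C%C *: D i.
have DG i : D i = \sum_k (U i k)%:C%C *: G k.
  apply/eqP; rewrite -subr_eq0; apply/eqP.
  (* The rows of 1 - U L annihilate C because L U = 1, so the D_i satisfy D = U (L D) = U G. *)
  rewrite -[RHS](cpsd_diff_linear (x := row i (1%:M - U *m L))); last first.
    by rewrite -row_mul CE mulmxA mulmxBl mul1mx -(mulmxA U) LU mulmx1 subrr
      mul0mx row0.
  rewrite (eq_bigr (fun j => ((1%:M : 'M[R]_n) i j)%:C%C *: D j -
      \sum_k (U i k * L k j)%:C%C *: D j)); last first.
    move=> j _; rewrite -scaler_suml -scalerBl -rmorph_sum -rmorphB.
    by rewrite !mxE.
  rewrite sumrB (bigD1 i) //= [\sum_(j | j != i) _]big1 ?addr0; last first.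
    by move=> j ji; rewrite mxE eq_sym (negPf ji) scale0r.
  rewrite mxE eqxx scale1r; congr (_ - _); rewrite exchange_big /=.
  apply: eq_bigr => k _; rewrite scaler_sumr; apply: eq_bigr => j _.
  by rewrite scalerA rmorphM.
exists T, G; split.
  rewrite /T -(cpsd_diff_sqr i0) cpsd_diff_trace C1.
  by rewrite rmorph1.
pose Q k l : 'M[R[i]]_d := G k *m G l + G l *m G k - ((k == l)%:R *+ 2) *: T.
suff Q0 k l a b : Q k l a b = 0.
  by move=> k l; apply/eqP; rewrite -subr_eq0; apply/eqP/matrixP=> a b; rewrite [RHS]mxE -(Q0 k l a b).
(* For a fixed entry (a, b), the Q_kl are the coefficients of a complex quadratic form. It vanishes
   at each row of [U] because D_i^2 = T and that row has norm 1. *)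
move: k l; apply: (extreme_gram_annihilatorC extC CE rC) => [k l|i].
  by rewrite /Q addrC eq_sym [in LHS]addrC [G k *m _ + _]addrC.
have sumQ : \sum_k \sum_l (U i k * U i l)%:C%C *: Q k l = 0.
  under eq_bigr => k _ do under eq_bigr => l _ do rewrite scalerBr rmorphM.
  under eq_bigr => k _ do rewrite sumrB.
  rewrite sumrB -anticomm_sum -!DG (cpsd_diff_sqr i i0) -/T -mulr2n.
  apply/eqP; rewrite subr_eq0 eq_sym -scaler_nat; apply/eqP.
  transitivity ((\sum_k U i k * U i k)%:C%C *: (2 *: T)).
    rewrite rmorph_sum scaler_suml; apply: eq_bigr => k _.
    rewrite (bigD1 k) //= big1 ?addr0 => [|l /negPf lk]; last first.
      by rewrite eq_sym lk mul0rn scale0r scaler0.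
    by rewrite eqxx rmorphM.
  have -> : \sum_k U i k * U i k = 1.
    by rewrite -(C1 i) [in RHS]CE mxE; apply: eq_bigr => k _; rewrite mxE.
  by rewrite rmorph1 scale1r.
have /matrixP/(_ a b) := sumQ; rewrite [RHS]mxE => Q0.
rewrite -[RHS]Q0 summxE; apply: eq_bigr => k _; rewrite summxE; apply: eq_bigr => l _.
by rewrite [RHS]mxE.
Qed.

End Factorization.
End LowerBound.

(** * The dimension bound and the conclusion *)

Lemma clifford_dim_bound (F : numClosedFieldType) d r (T : 'M[F]_d)
    (G : 'I_r -> 'M[F]_d) :
  \tr T != 0 ->
  (forall k l, G k *m G l + G l *m G k = ((k == l)%:R *+ 2) *: T) ->
  (2 ^ r./2 <= d)%N.
Proof.
move=> trT GG; have [l l0 /eigenvalueP[w0 w0T w00]] := exists_eigenvalue_neq0 trT.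
have two0 : (2 : F) != 0 by rewrite pnatr_eq0.
have sqG k : G k *m G k = T.
  have := GG k k; rewrite eqxx -mulr2n -scaler_nat => /(scalerI two0) //.
(* The default 0 is never reached: only indices below 2 floor(r/2) <= r occur. *)
pose A j := if insub j is Some k then G k else 0.
have AE k : A (nat_of_ord k) = G k by rewrite /A valK.
have lt_r j : (j < r./2.*2)%N -> (j < r)%N.
  by move=> /leq_trans; apply; rewrite -[leqRHS]odd_double_half leq_addl.
have W0 : eigenspace T l != 0.
  apply: contraNneq w00 => W0; rewrite -submx0 -W0; exact/eigenspaceP.
apply: leq_trans (rank_leq_row (eigenspace T l)).
apply: (clifford_rank_bound (A := A) two0 l0 W0) => [k w /lt_r lk|k w /lt_r lk|].
(* [T] is the square of each generator, so it commutes with them and its eigenspaces are stable. *)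
- move=> /eigenspaceP wT; apply/eigenspaceP; rewrite (AE (Ordinal lk)).
  by rewrite -{1}(sqG (Ordinal lk)) mulmxA -(mulmxA w) sqG wT scalemxAl.
- by move=> /eigenspaceP wT; rewrite (AE (Ordinal lk)) -mulmxA sqG.
move=> j k w /lt_r lj /lt_r lk jk _.
rewrite (AE (Ordinal lj)) (AE (Ordinal lk)) -!mulmxA -mulmxN; congr (_ *m _).
have ljk : (Ordinal lj == Ordinal lk) = false := negPf jk.
by apply/eqP; rewrite -addr_eq0 GG ljk mul0rn scale0r.
Qed.

Theorem theorem5p15 (R : realType) (n : nat) (hn : (1 <= n)%N)
    (C : 'M[R]_n) (hC : extreme_elliptope C)
    (hrank : (\rank C)%:Z = rmax R n) :
  gram_lorentz (PC C) /\ cpsd (PC C) /\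
  (forall (d : nat) (P : 'I_(n + n) -> 'M[R[i]]_d),
     cpsd_factorization (PC C) d P ->
     Num.sqrt (2 : R) ^+ (\rank C)./2 <= d%:R).
Proof.
have [[psdC C1] _] := hC; have [U CE] := psd_real_gram psdC.
split; first exact: gram_lorentz_PC CE C1.
split; first exact: cpsd_PC CE C1.
move=> d P facP.
have [T [G [trT GG]]] := cpsd_clifford hC CE erefl facP hn.
have le_d : (2 ^ (\rank C)./2 <= d)%N.
  by apply: clifford_dim_bound GG; rewrite trT oner_eq0.
apply: le_trans (_ : (2 ^ (\rank C)./2)%:R <= _); last by rewrite ler_nat.
(* The bases are compared: sqrt 2 <= sqrt (2^2) = 2. *)
rewrite natrX lerXn2r ?nnegrE ?sqrtr_ge0 //.
by rewrite -[leRHS](ger0_norm (ler0n R 2)) -sqrtr_sqr ler_wsqrtr // expr2 ler_peMr ?ler1n.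
Qed.
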